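(* Let $n,k,m$ be positive integers with $1\leq k\leq n-2$ and $1\leq m\leq n-k-1$. Then $$q(\overrightarrow{K}(n,k,m))=\frac{3n-m-4+\sqrt{(n-3m)^2+8mk}}{2}.$$
   Context: $q(D)$ is the spectral radius of the signless Laplacian matrix $Q(D)=\mathrm{diag}(d_1^+,\ldots,d_n^+)+A(D)$ of a digraph $D$, where $d_i^+$ is the outdegree of vertex $i$ and $A(D)$ is the adjacency matrix. $\overrightarrow{K}(n,k,m)$ is the digraph whose vertex set is the disjoint union of sets $S$, $V_1$, $V_2$ with $|S|=k$, $|V_1|=m$, $|V_2|=n-m-k$, and whose arcs are all ordered pairs $(u,v)$ of distinct vertices except those with $u\in V_2$ and $v\in V_1$. *)

(* Defs.v *)
From HB Require Import structures.
From mathcomp Require Import all_boot all_order all_algebra.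
From mathcomp Require Import all_classical all_reals.
From mathcomp Require Import complex.

Set Implicit Arguments.
Unset Strict Implicit.
Unset Printing Implicit Defensive.

Import Order.TTheory GRing.Theory Num.Theory.

Local Open Scope ring_scope.
Local Open Scope complex_scope.

Record digraph := Digraph {
  vertex :> finType;
  arc : rel vertex;
  arc_irr : irreflexive arc
}.

Definition outdeg (D : digraph) (u : D) : nat := #|[pred v | arc u v]|.

(* The vertices of D are numbered by enum_val : 'I_#|D| -> D. *)
Definition adjacency_mx (R : pzSemiRingType) (D : digraph) : 'M[R]_#|D| :=
  \matrix_(i, j) (arc (enum_val i) (enum_val j))%:R.

Definition outdeg_mx (R : pzSemiRingType) (D : digraph) : 'M[R]_#|D| :=
  diag_mx (\row_i (outdeg (enum_val i))%:R).

Definition signless_laplacian (R : pzSemiRingType) (D : digraph) :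
    'M[R]_#|D| :=
  outdeg_mx R D + adjacency_mx R D.

(* The supremum is a maximum when 0 < n, the spectrum being finite and
   nonempty. *)
Definition spectral_radius (R : realType) (n : nat) (A : 'M[R[i]]_n) : R :=
  sup [set complex.Re `|z| | z in [set z : R[i] | eigenvalue A z]]%classic.

Definition signless_spectral_radius (R : realType) (D : digraph) : R :=
  spectral_radius (signless_laplacian R[i] D).

Section K_digraph.
Variables n k m : nat.

(* S + V1 + V2, with n - m - k truncated at 0. *)
Definition K_vertex : finType := ('I_k + 'I_m + 'I_(n - m - k))%type.

Definition in_V1 (u : K_vertex) : bool :=
  if u is inl (inr _) then true else false.

Definition in_V2 (u : K_vertex) : bool :=
  if u is inr _ then true else false.

Definition K_arc : rel K_vertex :=
  [rel u v | (u != v) && ~~ (in_V2 u && in_V1 v)].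

Lemma K_arc_irr : irreflexive K_arc.
Proof. by move=> u; rewrite /K_arc /= eqxx. Qed.

Definition K_digraph : digraph := Digraph K_arc_irr.

End K_digraph.

(* Main.v *)
(** A left eigenvector v of a nonnegative matrix A, paired in absolute value
with a positive right eigenvector w for rho, gives
|z| <|v|, w> = <|v A|, w> <= <|v| A, w> = rho <|v|, w>, so every eigenvalue z
satisfies |z| <= rho, and rho is the spectral radius.  For the digraph K, such
a vector w is constant, equal to a, on S and V1, and constant, equal to b,
on V2; with a = |V2| the eigenvalue equation on S and V1 determines b from rho,
the one on V2 is a quadratic equation for rho, and its larger root makes b
positive. *)

Require Import Defs.
From HB Require Import structures.
From mathcomp Require Import all_boot all_order all_algebra.
From mathcomp Require Import all_classical all_reals.
From mathcomp Require Import complex.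
From mathcomp Require Import ring zify.

Set Implicit Arguments.
Unset Strict Implicit.
Unset Printing Implicit Defensive.

Import Order.TTheory GRing.Theory Num.Theory.

Local Open Scope ring_scope.

(** [eigenvalue] speaks of row vectors. If [a] had no left eigenvector, [A - a%:M] would be
    invertible, yet it kills [w]. *)
Lemma eigenvalue_right (F : fieldType) (n : nat) (A : 'M[F]_n) (w : 'cV[F]_n)
    (a : F) :
  A *m w = a *: w -> w != 0 -> eigenvalue A a.
Proof.
move=> Aw; apply: contraNT => /negPn; rewrite kermx_eq0 row_free_unit => uA.
by rewrite -(mulKmx uA w) mulmxBl Aw mul_scalar_mx subrr mulmx0.
Qed.

Lemma eigenvalue_norm_le (F : numFieldType) (n : nat) (A : 'M[F]_n)
    (w : 'cV[F]_n) (rho z : F) :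
  (forall i j, 0 <= A i j) -> (forall i, 0 < w i 0) ->
  A *m w = rho *: w -> eigenvalue A z -> `|z| <= rho.
Proof.
move=> A0 w0 Aw /eigenvalueP[v vA vN0].
have [j vj] : exists j, v 0 j != 0.
  by apply/existsP; apply: contraR vN0 => /existsPn v0; apply/eqP/rowP => j;
     rewrite mxE; apply/eqP/negPn/v0.
have vw : 0 < \sum_j `|v 0 j| * w j 0.
  rewrite (bigD1 j) //= ltr_pwDl ?mulr_gt0 ?normr_gt0 //.
  by apply: sumr_ge0 => i _; rewrite mulr_ge0 ?normr_ge0 ?ltW.
rewrite -(ler_pM2r vw) mulr_sumr.
(* The middle term is the pairing of [|v| A] with [w]: the triangle inequality bounds each entry of
   [|v A|], and exchanging the sums then lets [A] act on [w]. *)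
apply: (@le_trans _ _ (\sum_j (\sum_i `|v 0 i| * A i j) * w j 0)).
  apply: ler_sum => i _; rewrite mulrA ler_wpM2r ?(ltW (w0 i)) // -normrM.
  have /rowP/(_ i) := vA; rewrite !mxE => <-.
  apply: le_trans (ler_norm_sum _ _ _) _.
  by apply: ler_sum => l _; rewrite normrM (ger0_norm (A0 _ _)).
rewrite le_eqVlt; apply/orP; left; apply/eqP.
under eq_bigr do rewrite mulr_suml.
rewrite exchange_big mulr_sumr; apply: eq_bigr => i _ /=.
have /colP/(_ i) := Aw; rewrite !mxE => Awi.
by rewrite mulrCA -Awi mulr_sumr; apply: eq_bigr => l _; rewrite mulrA.
Qed.

Lemma spectral_radius_pos (R : realType) (n : nat) (A : 'M[R]_n)
    (w : 'cV[R]_n) (rho : R) :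
  (0 < n)%N -> (forall i j, 0 <= A i j) -> (forall i, 0 < w i 0) ->
  A *m w = rho *: w -> spectral_radius (map_mx (real_complex R) A) = rho.
Proof.
move=> n0 A0 w0 Aw; rewrite /spectral_radius.
pose wC := map_mx (real_complex R) w.
have AwC : map_mx (real_complex R) A *m wC = rho%:C%C *: wC.
  by rewrite -map_mxM Aw map_mxZ.
have wC0 i : 0 < wC i 0 by rewrite mxE ltcR.
have le_rho (z : R[i]) : eigenvalue (map_mx (real_complex R) A) z ->
    `|z| <= rho%:C%C.
  by apply: eigenvalue_norm_le wC0 AwC => i j; rewrite mxE lecR.
have rhoE : eigenvalue (map_mx (real_complex R) A) rho%:C%C.
  apply: eigenvalue_right AwC _; apply/eqP => wC_eq0.
  by have := wC0 (Ordinal n0); rewrite wC_eq0 mxE ltxx.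
(* The bound applied to the eigenvalue [rho] itself gives [0 <= |rho| <= rho]. *)
have rho0 : `|rho%:C%C| = rho%:C%C :> R[i].
  by apply/ger0_norm/(le_trans _ (le_rho _ rhoE)).
set E := [set _ | _ in _]%classic.
have Erho : E rho by exists rho%:C%C; rewrite ?rho0.
have ubE : ubound E rho.
  by move=> _ [z /le_rho + <-]; rewrite lecE => /andP[].
apply/eqP; rewrite eq_le; apply/andP; split.
  by apply: ge_sup => //; exists rho.
by apply: ub_le_sup => //; exists rho.
Qed.

Lemma map_signless_laplacian (R S : pzSemiRingType) (f : {rmorphism R -> S})
    (D : digraph) :
  map_mx f (signless_laplacian R D) = signless_laplacian S D.
Proof.
by apply/matrixP => i j; rewrite !mxE rmorphD !rmorphMn rmorph1.
Qed.

Lemma signless_laplacian_ge0 (R : numDomainType) (D : digraph) i j :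
  0 <= signless_laplacian R D i j.
Proof. by rewrite !mxE addr_ge0 ?mulrn_wge0. Qed.

(** The outdegree counts the arcs leaving a vertex, so the diagonal term spreads over them, one copy
    of [f (enum_val i)] per arc. *)
Lemma signless_laplacian_mul_col (R : pzRingType) (D : digraph) (f : D -> R) i :
  (signless_laplacian R D *m \col_j f (enum_val j)) i 0 =
  \sum_v (Defs.arc (enum_val i) v)%:R * (f (enum_val i) + f v).
Proof.
rewrite mulmxDl mul_diag_mx !mxE.
under [RHS]eq_bigr do rewrite mulrDr.
rewrite big_split /= -mulr_suml; congr (_ * _ + _).
  rewrite /outdeg -sum1_card natr_sum big_mkcond /=.
  by apply: eq_bigr => v _; rewrite inE; case: Defs.arc.
under eq_bigr do rewrite !mxE.
by rewrite -(big_enum_val (fun v => (Defs.arc (enum_val i) v)%:R * f v)).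
Qed.

Lemma signless_spectral_radius_pos (R : realType) (D : digraph) (f : D -> R)
    (rho : R) :
  (0 < #|D|)%N -> (forall u, 0 < f u) ->
  (forall u, \sum_v (Defs.arc u v)%:R * (f u + f v) = rho * f u) ->
  signless_spectral_radius R D = rho.
Proof.
move=> D0 f0 Qf; rewrite /signless_spectral_radius.
rewrite -(map_signless_laplacian (real_complex R)).
apply: (@spectral_radius_pos _ _ _ (\col_j f (enum_val j))) => //.
- exact: signless_laplacian_ge0.
- by move=> i; rewrite mxE.
- by apply/colP => i; rewrite signless_laplacian_mul_col Qf !mxE.
Qed.

(** Dropping the condition [u != v] adds just the term [g u]. What remains depends only on the
    blocks of [u] and [v], so a blockwise constant [g] is summed by counting. *)
Lemma sum_K_arc (R : pzRingType) (n k m : nat) (u : K_vertex n k m)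
    (g : K_vertex n k m -> R) :
  \sum_v (K_arc u v)%:R * g v =
  \sum_v (~~ (in_V2 u && in_V1 v))%:R * g v - g u.
Proof.
have NuV : ~~ (in_V2 u && in_V1 u) by case: u => [[]|].
rewrite (bigD1 u) // [in RHS](bigD1 u) //= K_arc_irr NuV.
rewrite mul0r mul1r add0r addrAC subrr add0r.
by apply: eq_bigr => v vu; rewrite /K_arc /= eq_sym vu.
Qed.

Theorem theorem6p3 (R : realType) (n k m : nat)
    (n_gt0 : (0 < n)%N) (k_gt0 : (1 <= k)%N) (k_le : (k <= n - 2)%N)
    (m_gt0 : (1 <= m)%N) (m_le : (m <= n - k - 1)%N) :
  signless_spectral_radius R (K_digraph n k m) =
  (3 * n%:R - m%:R - 4
     + Num.sqrt ((n%:R - 3 * m%:R) ^+ 2 + 8 * m%:R * k%:R)) / 2.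
Proof.
(* [p] is the size of V2; the bounds on [k] and [m] make the truncated subtraction exact and [p]
   positive. *)
have [p p_gt0 pE] : exists2 p, (0 < p)%N & (n - m - k)%N = p.
  by exists (n - m - k)%N => //; lia.
have nE : n%:R = k%:R + m%:R + p%:R :> R.
  by rewrite -!natrD; congr (_%:R); lia.
have K0 : 0 < k%:R :> R by rewrite ltr0n.
have M0 : 0 < m%:R :> R by rewrite ltr0n.
have P0 : 0 < p%:R :> R by rewrite ltr0n.
set d := (X in Num.sqrt X); set s := Num.sqrt d; set rho := (X in _ = X).
have d0 : 0 <= d by rewrite addr_ge0 ?sqr_ge0 // !mulr_ge0 // ltW.
have sE : s ^+ 2 = d by rewrite sqr_sqrtr.
have s0 : 0 <= s by apply: sqrtr_ge0.
(* With [a = p] the equation on S and V1 reads [rho = 2 * (k + m) + p - 2 + b]; this is its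
   solution. *)
pose a : R := p%:R; pose b : R := (s - (k%:R + 2 * m%:R - p%:R)) / 2.
have b0 : 0 < b.
  (* Passing to the absolute value allows squares to be compared:
     [d - (k + 2 * m - p) ^+ 2 = 4 * k * p]. *)
  rewrite divr_gt0 // subr_gt0; apply: le_lt_trans (ler_norm _) _.
  rewrite -(@ltr_pXn2r _ 2) ?nnegrE // real_normK ?num_real // sE /d nE.
  rewrite -subr_gt0 [X in 0 < X](_ : _ = 4 * k%:R * p%:R); last by ring.
  by rewrite !mulr_gt0.
pose f (u : K_digraph n k m) := if in_V2 u then b else a.
apply: (@signless_spectral_radius_pos _ _ f).
- by apply/card_gt0P; exists (inl (inl (Ordinal k_gt0))).
- by move=> u; rewrite /f; case: ifP.
move=> u; rewrite sum_K_arc !big_sumType /= /f /=.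
rewrite !sumr_const !card_ord -!(mulr_natl (_ * _)) pE.
case: u => [[u|u]|u] /=.
- by rewrite /rho -/s /a /b nE; field.
- by rewrite /rho -/s /a /b nE; field.
- rewrite /rho -/s /a /b nE; move: sE; rewrite /d nE => sE.
  apply/eqP; rewrite -subr_eq0; apply/eqP.
  (* On V2 the two sides differ by [(d - s ^+ 2) / 4], which vanishes by the choice of [s]. *)
  transitivity (((k%:R + m%:R + p%:R - 3 * m%:R) ^+ 2 + 8 * m%:R * k%:R
                 - s ^+ 2) / 4 : R).
    by field.
  by rewrite sE subrr mul0r.
Qed.
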